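(* Let $\mathcal{A}\subset\mathbb{R}$ be a set of size $4$. If the sum of the largest and the smallest elements of $\mathcal{A}$ equals the sum of the other two elements, then $C(\mathcal{A})=2$. If this condition is not satisfied, then $C(\mathcal{A})=3$.
   Context: For a finite set $\mathcal{A}\subset\mathbb{R}$, the complexity $C(\mathcal{A})$ is the smallest positive integer $\theta$ for which there exist (not necessarily distinct) real numbers $x_1,\dots,x_\theta,y_1,\dots,y_\theta$ with $\mathcal{A}\subseteq\{x_1,y_1\}+\{x_2,y_2\}+\cdots+\{x_\theta,y_\theta\}$, where $+$ denotes the sumset $\mathcal{S}+\mathcal{T}=\{s+t\mid s\in\mathcal{S},t\in\mathcal{T}\}$. *)

(* Defs.v *)
From mathcomp Require Import all_boot all_order all_algebra finmap.
From mathcomp Require Import boolp reals.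

Set Implicit Arguments.
Unset Strict Implicit.
Unset Printing Implicit Defensive.

Import Order.TTheory GRing.Theory Num.Theory.
Local Open Scope fset_scope.
Local Open Scope ring_scope.

Definition sumset (R : realType) (S T : {fset R}) : {fset R} :=
  [fset s + t | s in S, t in T].

(* The sumset of zero summands is [fset 0], the neutral element of sumset. *)
Definition sum_of_pairs (R : realType) (n : nat) (x y : 'I_n -> R) : {fset R} :=
  \big[@sumset R/[fset 0]]_(i < n) [fset x i; y i].

Definition covered_by_pairs (R : realType) (A : {fset R}) (n : nat) : Prop :=
  exists x y : 'I_n -> R, A `<=` sum_of_pairs x y.

Lemma sub_sum_of_pairs (R : realType) (s : seq R) :
  {subset 0 :: s <= sum_of_pairs (fun=> 0) (fun i : 'I_(size s) => s`_i)}.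
Proof.
elim: s => [|a s IHs] z; rewrite /sum_of_pairs.
  by rewrite big_ord0 !inE.
rewrite big_ord_recl /= => zs.
have [->|za] := eqVneq z a.
  apply/imfset2P; exists a; first by rewrite !inE eqxx orbT.
  by exists 0; [apply: IHs; rewrite inE eqxx | rewrite addr0].
apply/imfset2P; exists 0; first by rewrite !inE eqxx.
exists z; last by rewrite add0r.
by apply: IHs; move: zs; rewrite !inE (negPf za).
Qed.

Lemma covered_by_pairs_ex (R : realType) (A : {fset R}) :
  exists n, `[< (0 < n)%N /\ covered_by_pairs A n >].
Proof.
exists (size (0 :: A : seq R)); apply/asboolP; split=> //.
exists (fun=> 0), (fun i => (0 :: A : seq R)`_i); apply/fsubsetP => z zA.
by apply: sub_sum_of_pairs; rewrite !inE zA !orbT.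
Qed.

Definition complexity (R : realType) (A : {fset R}) : nat :=
  ex_minn (covered_by_pairs_ex A).

(* Main.v *)
(* Write A = {m < p < q < M}.  The sumset {m, p} + {0, q - m} contains m, p, q
   and p + q - m, which is M exactly when M + m = p + q; adding {0, M - m}
   always reaches M.  Conversely, if two pairs cover A then the four sums
   x1 + x2, x1 + y2, y1 + x2, y1 + y2 are the elements of A in some order, and
   x1 + x2 and y1 + y2 have the same sum as x1 + y2 and y1 + x2; as the elements
   of A are distinct and ordered, the only two disjoint pairs that can have
   equal sums are {m, M} and {p, q}. *)
Require Import Defs.
From mathcomp Require Import all_boot all_order all_algebra finmap.
From mathcomp Require Import boolp reals.
From mathcomp Require Import lra.

Set Implicit Arguments.
Unset Strict Implicit.
Unset Printing Implicit Defensive.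

Import Order.TTheory GRing.Theory Num.Theory.
Local Open Scope fset_scope.
Local Open Scope ring_scope.

Lemma mem_sum_of_pairs0 (R : realType) (x y : 'I_0 -> R) (z : R) :
  (z \in sum_of_pairs x y) = (z == 0).
Proof. by rewrite /sum_of_pairs big_ord0 inE. Qed.

(** Iterated down to the empty sum, this turns membership into a disjunction of linear equations,
    one per choice of a summand in each pair, ready for [lra]. *)
Lemma mem_sum_of_pairsS (R : realType) (n : nat) (x y : 'I_n.+1 -> R) (z : R) :
  let S := sum_of_pairs (x \o lift ord0) (y \o lift ord0) in
  (z \in sum_of_pairs x y) = (z - x ord0 \in S) || (z - y ord0 \in S).
Proof.
move=> S; rewrite /sum_of_pairs big_ord_recl.
apply/imfset2P/orP => [[a /fset2P[]-> [b bS ->]]|[zS|zS]].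
- by left; rewrite addrC addKr.
- by right; rewrite addrC addKr.
- by exists (x ord0); [rewrite !inE eqxx | exists (z - x ord0); rewrite ?subrKC].
- by exists (y ord0); [rewrite !inE eqxx orbT | exists (z - y ord0); rewrite ?subrKC].
Qed.

Lemma complexity_eq (R : realType) (A : {fset R}) (n : nat) :
    (0 < n)%N -> covered_by_pairs A n ->
    (forall k, (0 < k < n)%N -> ~ covered_by_pairs A k) ->
  complexity A = n.
Proof.
move=> n0 An minA; rewrite /complexity.
case: ex_minnP => k /asboolP[k0 Ak] kmin.
have kn : (k <= n)%N by apply: kmin; apply/asboolP.
apply/eqP; rewrite eqn_leq kn leqNgt; apply/negP => lkn.
by apply: (minA k) => //; rewrite k0.
Qed.

(** A further pair replaces a sumset by the union of two of its translates, so the size at most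
    doubles. With [n = 1] this keeps a single pair from covering four elements. *)
Lemma card_sum_of_pairs (R : realType) (n : nat) (x y : 'I_n -> R) :
  (#|` sum_of_pairs x y| <= 2 ^ n)%N.
Proof.
elim: n x y => [|n IHn] x y; first by rewrite /sum_of_pairs big_ord0 cardfs1.
set S := sum_of_pairs (x \o lift ord0) (y \o lift ord0).
have sub : sum_of_pairs x y `<=`
    [fset x ord0 + s | s in S] `|` [fset y ord0 + s | s in S].
  apply/fsubsetP => z; rewrite mem_sum_of_pairsS in_fsetU => /orP[] zS; apply/orP.
    by left; apply/imfsetP; exists (z - x ord0); rewrite ?subrKC.
  by right; apply/imfsetP; exists (z - y ord0); rewrite ?subrKC.
apply: leq_trans (fsubset_leq_card sub) _.
apply: leq_trans (_ : _ <= #|` S| + #|` S|)%N _.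
  by rewrite cardfsU (leq_trans (leq_subr _ _))// leq_add// leq_imfset_card.
by rewrite expnS mul2n -addnn leq_add// IHn.
Qed.

Lemma cardfs2_ex (K : choiceType) (B : {fset K}) :
  #|` B| = 2%N -> exists p q, p != q /\ B = [fset p; q].
Proof.
move=> B2; have := fset_uniq B; move: B2.
case BE: (enum_fset B) => [|p [|q []]] //= _.
rewrite inE andbT => pq; exists p, q; split=> //.
by apply/fsetP => z; rewrite -[z \in B]/(z \in enum_fset B) BE !inE.
Qed.

(** Removing the distinct extremes leaves two elements; naming them in increasing order makes the
    condition of the theorem the linear equation [M + m = p + q]. *)
Lemma sorted_fset4 (R : realType) (A : {fset R}) (m M : R) :
    #|` A| = 4%N -> m \in A -> (forall x, x \in A -> m <= x) ->
    M \in A -> (forall x, x \in A -> x <= M) ->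
  exists p q : R, [/\ m < p, p < q, q < M, A =i [fset m; p; q; M]
    & \sum_(x <- A `\` [fset m; M]) x = p + q].
Proof.
move=> hA mA m_min MA M_max.
have mM : m != M.
  apply/eqP => mM.
  suff /fsubset_leq_card : A `<=` [fset m] by rewrite hA cardfs1.
  by apply/fsubsetP => x xA; rewrite inE eq_le m_min // mM M_max.
have sub : [fset m; M] `<=` A by apply/fsubsetP => x /fset2P[]->.
have B2 : #|` A `\` [fset m; M]| = 2%N.
  by rewrite cardfsD (fsetIidPr sub) hA cardfs2 mM.
have inB x : (x \in A `\` [fset m; M]) = (x != m) && (x != M) && (x \in A).
  by rewrite !inE negb_or.
have [p [q [lpq BE]]] : exists p q, p < q /\ A `\` [fset m; M] = [fset p; q].
  have [p [q [pq ->]]] := cardfs2_ex B2.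
  have [lpq|lqp|pqE] := ltgtP p q; first by exists p, q.
    by exists q, p; rewrite fsetUC.
  by rewrite pqE eqxx in pq.
have [] : p \in [fset p; q] /\ q \in [fset p; q] by rewrite !inE !eqxx orbT.
rewrite -BE !inB => /andP[/andP[pm pM] pA] /andP[/andP[qm qM] qA].
exists p, q; split => //.
- by rewrite lt_neqAle eq_sym pm m_min.
- by rewrite lt_neqAle qM M_max.
- move=> x; have := inB x; rewrite BE !inE.
  have [->|_] /= := eqVneq x m; first by rewrite mA.
  have [->|_] /= := eqVneq x M; first by rewrite MA orbT.
  by rewrite orbF => ->.
- by rewrite BE big_fsetU1 ?big_seq_fset1 // inE lt_eqF.
Qed.

Theorem proposition4 (R : realType) (A : {fset R}) (hA : #|` A| = 4%N)
    (m M : R) (mA : m \in A) (m_min : forall x, x \in A -> m <= x)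
    (MA : M \in A) (M_max : forall x, x \in A -> x <= M) :
  (M + m = \sum_(x <- A `\` [fset m; M]) x -> complexity A = 2%N) /\
  (M + m <> \sum_(x <- A `\` [fset m; M]) x -> complexity A = 3%N).
Proof.
have [p [q [mp pq qM AE ->]]] := sorted_fset4 hA mA m_min MA M_max.
have not1 : ~ covered_by_pairs A 1.
  move=> [x [y /fsubset_leq_card]]; rewrite hA => le4.
  by have := leq_trans le4 (card_sum_of_pairs x y).
split=> sumE; apply: complexity_eq => //.
- exists (fun i => [:: m; 0]`_i), (fun i => [:: p; q - m]`_i).
  apply/fsubsetP => z; rewrite AE !inE.
  rewrite !mem_sum_of_pairsS !mem_sum_of_pairs0 /= -!orbA.
  (* The disjuncts stand for the sums [m + 0], [m + (q - m)], [p + 0], [p + (q - m)], in this order;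
     [sumE] identifies the last with [M]. *)
  case/or4P=> /eqP->; apply/or4P.
  + by constructor 1; apply/eqP; lra.
  + by constructor 3; apply/eqP; lra.
  + by constructor 2; apply/eqP; lra.
  + by constructor 4; apply/eqP; lra.
- by case=> [|[|k]].
- exists (fun i => [:: m; 0; 0]`_i), (fun i => [:: p; q - m; M - m]`_i).
  apply/fsubsetP => z; rewrite AE !inE.
  rewrite !mem_sum_of_pairsS !mem_sum_of_pairs0 /= => /orP[/orP[/orP[]|]|] /eqP->.
  + by rewrite (_ : m - m - 0 - 0 = 0) ?eqxx //; lra.
  + by rewrite (_ : p - p - 0 - 0 = 0) ?eqxx ?orbT //; lra.
  + by rewrite (_ : q - m - (q - m) - 0 = 0) ?eqxx ?orbT //; lra.
  + by rewrite (_ : M - m - 0 - (M - m) = 0) ?eqxx ?orbT //; lra.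
(* Only two pairs remain to be excluded: [not1] settles one pair, and the bounds remove all other
   values. *)
- case=> [|[|[|k]]] // _ [x [y /fsubsetP sub]].
  have {}sub z : z \in [fset m; p; q; M] -> z \in sum_of_pairs x y.
    by rewrite -AE; exact: sub.
  (* Each element becomes one of four sums. Once [sumE] has turned the goal into [M + m = p + q],
     every case is linear: it contradicts the strict order or yields this equation. *)
  have := (sub m, sub p, sub q, sub M).
  rewrite !inE !eqxx !orbT /= !mem_sum_of_pairsS !mem_sum_of_pairs0 /=.
  set a := x _; set b := y _; set c := x _; set d := y _.
  move=> [[[/(_ isT) hm /(_ isT) hp] /(_ isT) hq] /(_ isT) hM].
  (* One case for each map from A to the four sums. *)
  by move: hm hp hq hM; do 4 (move=> /orP[/orP[]|/orP[]] /eqP ?); apply: sumE; lra.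
Qed.
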